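(* For $\alpha \in (0, 2)$ and a number $n \ge 2$, define functions on $\mathbb{R}$ by \[ \varphi_\alpha(s) = s^{\langle\alpha\rangle} , \qquad \varphi_{\alpha, n}(s) = \begin{cases} s & \text{if } |s| < 1, \\ s^{\langle\alpha\rangle} & \text{if } 1 \le |s| < n^4, \\ n^{4 \alpha} \operatorname{sign} s & \text{if } n^4 \le |s|, \end{cases} \] \[ \psi_n(s) = \begin{cases} s & \text{if } |s| < n, \\ n \operatorname{sign} s & \text{if } n \le |s| < n^3, \\ s - (n^3 - n) \operatorname{sign} s & \text{if } n^3 \le |s|. \end{cases} \] Then, for every $\alpha \in (0,2)$, \begin{align*} & \Bigl| (\varphi_{\alpha, n}(t) - \varphi_{\alpha, n}(s)) (\varphi_{2 - \alpha, n}(t) - \varphi_{2 - \alpha, n}(s)) - (\varphi_\alpha(t) - \varphi_\alpha(s))(\varphi_{2 - \alpha}(t) - \varphi_{2 - \alpha}(s)) \Bigr| \\ & \qquad \le 8 n^{-\min\{\alpha, 2 - \alpha\}} (t - s)^2 + 180 (\psi_n(t) - \psi_n(s))^2 \end{align*} for all $n \ge 2$ and all $s, t \in \mathbb{R}$.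
   Context: For $s \in \mathbb{R}$ and $\alpha > 0$, $s^{\langle\alpha\rangle} = |s|^\alpha \operatorname{sign} s$. The functions $\varphi_{2-\alpha}$ and $\varphi_{2-\alpha,n}$ are obtained from the definitions of $\varphi_\alpha$ and $\varphi_{\alpha,n}$ by replacing $\alpha$ with $2-\alpha \in (0,2)$. *)

(* Defs.v *)
From mathcomp Require Import all_boot all_order all_algebra.
From mathcomp Require Import reals exp.

Set Implicit Arguments.
Unset Strict Implicit.
Unset Printing Implicit Defensive.

Import Order.TTheory GRing.Theory Num.Theory.
Local Open Scope ring_scope.

(* The signed power s^<a>, meant for a > 0.  Beware that 0 `^ 0 = 1 and that
   `^ is only meaningful for a nonnegative base. *)
Definition spow (R : realType) (s a : R) : R := `|s| `^ a * Num.sg s.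

Definition phi (R : realType) (alpha s : R) : R := spow s alpha.

Definition phi_trunc (R : realType) (alpha n s : R) : R :=
  if `|s| < 1 then s
  else if `|s| < n ^+ 4 then spow s alpha
  else n `^ (4 * alpha) * Num.sg s.

Definition psi (R : realType) (n s : R) : R :=
  if `|s| < n then s
  else if `|s| < n ^+ 3 then n * Num.sg s
  else s - (n ^+ 3 - n) * Num.sg s.

(* Main.v *)
(* Write I and J for the truncated and the untruncated product of increments.
   Both are of the form (F t - F s) (G t - G s) with F, G odd, nondecreasing and
   F x * G x = x^2 (for I after clamping the arguments at n^4, which is
   1-Lipschitz), so both lie between 0 and 2 (t - s)^2.  Hence
   |I - J| <= 2 (t - s)^2, which settles every case where t - s is comparable to
   psi_n t - psi_n s.  By symmetry let |s| <= t and alpha <= 1.  If t >= n^4,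
   then t - s <= 3 (psi_n t - psi_n s).  If 1 <= |s| and t < n^4, then I = J.
   If |s| < 1 and t < n, then psi_n t - psi_n s = t - s.  Finally, if |s| < 1 and
   n <= t < n^4, the terms t^2 in I and J cancel, leaving
   |I - J| <= t^(2 - alpha) <= n^(- alpha) t^2. *)
Require Import Defs.
From mathcomp Require Import all_boot all_order all_algebra.
From mathcomp Require Import reals exp.
From mathcomp Require Import ring lra.
Import Order.TTheory GRing.Theory Num.Theory.
Local Open Scope ring_scope.

Set Implicit Arguments.
Unset Strict Implicit.
Unset Printing Implicit Defensive.

(** * Increments of odd nondecreasing functions *)

Lemma odd0 (R : realType) (F : R -> R) : (forall x, F (- x) = - F x) -> F 0 = 0.
Proof. by move=> oddF; have := oddF 0; rewrite oppr0; lra. Qed.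

Lemma odd_nondecreasing (R : realType) (F : R -> R) :
  (forall x, F (- x) = - F x) ->
  (forall x y, 0 <= x -> x <= y -> F x <= F y) ->
  {homo F : x y / x <= y}.
Proof.
move=> oddF homoF x y le_xy; have F0 := odd0 oddF.
have [x0|x0] := leP 0 x; first exact: homoF.
have [y0|y0] := leP 0 y.
  have := homoF 0 y (lexx _) y0; have := homoF 0 (- x) (lexx _).
  by rewrite F0 oddF => /(_ ltac:(lra)); lra.
by have := homoF (- y) (- x) ltac:(lra) ltac:(lra); rewrite !oddF; lra.
Qed.

(** The product expands to [s ^+ 2 + t ^+ 2] minus the cross terms [F t * G s + F s * G t]. For
    [0 <= s * t], AM-GM bounds these below by [2 * (s * t)]; the factor 2 in the bound serves
    opposite signs. *)
Lemma incr_prod_bound (R : realType) (F G : R -> R) (s t : R) :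
  (forall x, F (- x) = - F x) -> (forall x, G (- x) = - G x) ->
  {homo F : x y / x <= y} -> {homo G : x y / x <= y} ->
  (forall x, F x * G x = x ^+ 2) ->
  0 <= (F t - F s) * (G t - G s) <= 2 * (t - s) ^+ 2.
Proof.
move=> oddF oddG homoF homoG FG.
have incr_ge0 x y : 0 <= (F x - F y) * (G x - G y).
  have [xy|/ltW xy] := leP y x.
    by apply: mulr_ge0; rewrite subr_ge0; [exact: homoF|exact: homoG].
  by apply: mulr_le0; rewrite subr_le0; [exact: homoF|exact: homoG].
apply/andP; split=> //.
have incrE x y :
    (F x - F y) * (G x - G y) = x ^+ 2 + y ^+ 2 - (F x * G y + F y * G x).
  by rewrite -!FG; ring.
have [st0|st0] := leP 0 (s * t); last first.
  (* By oddness, passing to [- s] flips the cross terms, so they are at least [- (s ^+ 2 + t ^+ 2)],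
     and [s ^+ 2 + t ^+ 2 <= (t - s) ^+ 2] because [s * t < 0]. *)
  have := incr_ge0 t (- s); rewrite !incrE oddF oddG sqrrN => ?.
  by nra.
have sgnH (H : R -> R) : (forall x, H (- x) = - H x) ->
    {homo H : x y / x <= y} -> forall x, 0 <= H x * x.
  move=> oddH homoH x; have H0 := odd0 oddH.
  have [x0|/ltW x0] := leP 0 x; have := homoH _ _ x0; rewrite H0 => ?.
    exact: mulr_ge0.
  exact: mulr_le0.
have cross x y : 0 <= x * y -> 0 <= F x * G y.
  move=> xy0; have [x0|x0] := eqVneq x 0; first by rewrite x0 odd0// mul0r.
  have [y0|y0] := eqVneq y 0; first by rewrite y0 (odd0 oddG) mulr0.
  have xy_gt0 : 0 < x * y by rewrite lt_neqAle xy0 eq_sym mulf_neq0.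
  rewrite -(pmulr_lge0 _ xy_gt0).
  rewrite (_ : F x * G y * (x * y) = F x * x * (G y * y)); last by ring.
  by apply: mulr_ge0; exact: sgnH.
have A0 : 0 <= F t * G s by apply: cross; rewrite mulrC.
have B0 : 0 <= F s * G t by exact: cross.
have AB : (F t * G s) * (F s * G t) = (s * t) ^+ 2.
  by rewrite exprMn -!FG; ring.
(* AM-GM, the product of the two cross terms being [(s * t) ^+ 2] *)
have amgm : 2 * (s * t) <= F t * G s + F s * G t.
  rewrite -(@ler_pXn2r _ 2) ?nnegrE//; [|lra|lra].
  by rewrite exprMn -AB; have := sqr_ge0 (F t * G s - F s * G t); nra.
by rewrite incrE; have := sqr_ge0 (t - s); nra.
Qed.

(** * Signed powers and their truncations *)

Section SignedPower.
Variable R : realType.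
Implicit Types a b x y n M s t : R.

Lemma spowN a x : spow (- x) a = - spow x a.
Proof. by rewrite /spow normrN sgrN mulrN. Qed.

Lemma ger0_spow a x : 0 < a -> 0 <= x -> spow x a = x `^ a.
Proof.
move=> a0; rewrite le_eqVlt /spow => /orP[/eqP <-|x0].
  by rewrite sgr0 mulr0 powR0// gt_eqF.
by rewrite gtr0_norm// gtr0_sg// mulr1.
Qed.

Lemma spow_homo a : 0 < a -> {homo (fun x => spow x a) : x y / x <= y}.
Proof.
move=> a0; apply: odd_nondecreasing; first exact: spowN.
move=> x y x0 xy; have y0 := le_trans x0 xy.
by rewrite !ger0_spow// ge0_ler_powR// ?nnegrE// ltW.
Qed.

Lemma powR_conj a b x : a + b = 2 -> 0 <= x -> x `^ a * x `^ b = x ^+ 2.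
Proof.
by move=> ab x0; rewrite -powRD ab ?pnatr_eq0//= powR_mulrn.
Qed.

Lemma spow_conj a b x : a + b = 2 -> spow x a * spow x b = x ^+ 2.
Proof.
move=> ab; rewrite /spow mulrACA powR_conj// -expr2 -exprMn.
by rewrite mulrC mulr_sg_norm.
Qed.

(** The cut at [n ^+ 4] in [phi_trunc] would break the identity [F x * G x = x ^+ 2], so it is left
    out here and moved to the argument through [clamp]. *)
Definition lin_spow a x : R := if `|x| < 1 then x else spow x a.

Lemma lin_spowN a x : lin_spow a (- x) = - lin_spow a x.
Proof. by rewrite /lin_spow normrN; case: ifP => // _; exact: spowN. Qed.

Lemma lin_spow_homo a : 0 < a -> {homo lin_spow a : x y / x <= y}.
Proof.
move=> a0; apply: odd_nondecreasing; first exact: lin_spowN.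
move=> x y x0 xy; have y0 := le_trans x0 xy.
rewrite /lin_spow !ger0_norm//.
case: (ltP x 1) => x1; case: (ltP y 1) => y1 //; last exact: spow_homo.
(* Across the threshold, [x < 1 = y]^ 0 <= y [^ a]. *)
- apply: le_trans (ltW x1) _; rewrite ger0_spow//.
  by rewrite -[leLHS](powRr0 y) ler_powR// ltW.
- lra.
Qed.

Lemma lin_spow_conj a b x :
  a + b = 2 -> lin_spow a x * lin_spow b x = x ^+ 2.
Proof. by move=> ab; rewrite /lin_spow; case: ifP => // _; exact: spow_conj. Qed.

Definition clamp M x : R := if `|x| < M then x else M * Num.sg x.

Lemma clamp_dist M s t : 0 < M -> (clamp M t - clamp M s) ^+ 2 <= (t - s) ^+ 2.
Proof.
move=> M0; rewrite -[leLHS]real_normK ?num_real// -[leRHS]real_normK ?num_real//.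
rewrite ler_pXn2r ?nnegrE// ler_norml /clamp.
by case: (ltP `|s| M); case: (ltP `|t| M); case: (sgrP s) => s0;
  case: (sgrP t) => t0 ? ?; case: (ler0P (t - s)) => ?; apply/andP; split; lra.
Qed.

Lemma phi_trunc_clamp a n x : 1 <= n ->
  phi_trunc a n x = lin_spow a (clamp (n ^+ 4) x).
Proof.
move=> n1; have N1 : 1 <= n ^+ 4 by exact: exprn_ege1.
rewrite /phi_trunc /lin_spow /clamp.
have [x1|x1] := ltP `|x| 1; first by rewrite (lt_le_trans x1 N1) x1.
have [xN|xN] := ltP `|x| (n ^+ 4); first by rewrite ltNge x1.
have x0 : x != 0 by rewrite -normr_gt0 (lt_le_trans ltr01 x1).
have n0 : 0 <= n by lra.
rewrite normrM normr_sg x0 mulr1 ger0_norm ?exprn_ge0// ltNge N1 /=.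
rewrite /spow normrM normr_sg x0 mulr1 ger0_norm ?exprn_ge0//.
rewrite sgrM sgr_id (gtr0_sg (lt_le_trans ltr01 N1)) mul1r.
by rewrite -powR_mulrn// -powRrM.
Qed.

Definition phi_incr a b s t : R :=
  (phi a t - phi a s) * (phi b t - phi b s).

Definition trunc_incr a b n s t : R :=
  (phi_trunc a n t - phi_trunc a n s) * (phi_trunc b n t - phi_trunc b n s).

Lemma incr_diff_bound a b n s t : 0 < a -> 0 < b -> a + b = 2 -> 1 <= n ->
  `|trunc_incr a b n s t - phi_incr a b s t| <= 2 * (t - s) ^+ 2.
Proof.
move=> a0 b0 ab n1.
have /andP[P0 P2] : 0 <= phi_incr a b s t <= 2 * (t - s) ^+ 2.
  by apply: incr_prod_bound => [x|x|||x]; rewrite /phi ?spowN ?spow_conj//;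
    apply: spow_homo.
have /andP[T0 T2] : 0 <= trunc_incr a b n s t <=
    2 * (clamp (n ^+ 4) t - clamp (n ^+ 4) s) ^+ 2.
  rewrite /trunc_incr !phi_trunc_clamp//.
  by apply: incr_prod_bound => [x|x|||x]; rewrite ?lin_spowN ?lin_spow_conj//;
    apply: lin_spow_homo.
have := @clamp_dist (n ^+ 4) s t ltac:(apply: exprn_gt0; lra).
by rewrite ler_norml; lra.
Qed.

Lemma psiN n x : psi n (- x) = - psi n x.
Proof. by rewrite /psi normrN sgrN; do 2 case: ifP => // _; ring. Qed.

Lemma phi_truncN a n x : phi_trunc a n (- x) = - phi_trunc a n x.
Proof.
by rewrite /phi_trunc normrN sgrN spowN; do 2 case: ifP => // _; ring.
Qed.

(** [psi n] has slope 1 except on two flat pieces of length [n ^+ 3 - n], one on each side of 0.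
    Since [2 * n ^+ 3 <= t], they make up at most two thirds of the way from [s] to [t]. *)
Lemma psi_far n s t : 2 <= n -> `|s| <= t -> n ^+ 4 <= t ->
  (t - s) ^+ 2 <= 9 * (psi n t - psi n s) ^+ 2.
Proof.
move=> n2 st nt; have n3 : 4 * n <= n ^+ 3 by nra.
have n4 : 2 * n ^+ 3 <= t by apply: le_trans nt; rewrite (exprS n 3); nra.
suff le3 : 0 <= t - s <= 3 * (psi n t - psi n s).
  rewrite (_ : 9 = 3 ^+ 2); last by ring.
  by rewrite -exprMn ler_pXn2r ?nnegrE//; lra.
have t0 : 0 < t by lra.
have ge_tn : n <= t by lra.
have ge_tn3 : n ^+ 3 <= t by lra.
rewrite /psi (gtr0_norm t0) gtr0_sg// (le_gtF ge_tn) (le_gtF ge_tn3) mulr1.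
(* With [n ^+ 3] abstracted to [N], every remaining case is linear. *)
move: (n ^+ 3) n3 n4 ge_tn3 => N n3 n4 ge_tN {nt}.
case: (ltP `|s| n) => sn.
  by have le_s := ler_norm s; apply/andP; split; lra.
case: (ltP `|s| N) => sN; case: (sgrP s) st sn sN => s0 st sn sN;
  apply/andP; split; lra.
Qed.

Lemma incr_diff_mid a b n s t : 0 < a -> a <= b -> a + b = 2 -> 2 <= n ->
  `|s| < 1 -> n <= t -> t < n ^+ 4 ->
  `|trunc_incr a b n s t - phi_incr a b s t| <= 4 * n `^ (- a) * (t - s) ^+ 2.
Proof.
move=> a0 le_ab ab n2 s1 nt tn.
have b0 : 0 < b by lra.
have t0 : 0 < t by lra.
rewrite /trunc_incr /phi_incr /phi /phi_trunc s1 (gtr0_norm t0) tn.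
rewrite ltNge (_ : 1 <= t); last by lra.
rewrite /= !(@ger0_spow _ t) ?(ltW t0)//.
have tt := @powR_conj _ _ t ab (ltW t0).
have ss := @spow_conj _ _ s ab.
(* Both [t ^+ 2] and [s ^+ 2] cancel between the two products. *)
rewrite (_ : _ - _ = t `^ a * (spow s b - s) + t `^ b * (spow s a - s));
  last by ring: ss.
have tb : t `^ b <= n `^ (- a) * t ^+ 2.
  have na0 : 0 < n `^ a by apply: powR_gt0; lra.
  have nta : n `^ a <= t `^ a by apply: ge0_ler_powR; rewrite ?nnegrE; lra.
  rewrite powRN mulrC ler_pdivlMr// -tt mulrC.
  by apply: ler_wpM2r nta; exact: powR_ge0.
have tab : t `^ a <= t `^ b by rewrite ler_powR//; lra.
have ta0 : 0 <= t `^ a by exact: powR_ge0.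
apply: (@le_trans _ _ (t `^ b)).
  have pinch x : 0 <= x -> x <= 1 -> [/\ 0 <= spow x b, spow x b <= x,
      x <= spow x a & spow x a <= 1].
    move=> x0 x1; rewrite !ger0_spow// powR_ge0.
    move: x0; rewrite le_eqVlt => /orP[/eqP <-|x0].
      by rewrite !powR0 ?gt_eqF.
    have powx c d : c <= d -> x `^ d <= x `^ c.
      by move=> cd; rewrite ger_powR// x0.
    have := powx _ _ (ltac:(lra) : a <= 1).
    have := powx _ _ (ltac:(lra) : 1 <= b).
    have := powx _ _ (ltW a0); rewrite powRr0 powRr1; first by [].
    exact: ltW.
  move: s1; rewrite ltr_norml => /andP[s1 s2]; rewrite ler_norml.
  have [s0|/ltW s0] := leP 0 s.
    by have [? ? ? ?] := pinch s s0 (ltW s2); apply/andP; split; nra.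
  have [] := pinch (- s) ltac:(lra) ltac:(lra); rewrite !spowN => ? ? ? ?.
  by apply/andP; split; nra.
apply: le_trans tb _; rewrite -mulrA [leRHS]mulrCA ler_wpM2l ?powR_ge0//.
(* The constant 4 comes from [t <= 2 * (t - s)], as [s < 1] and [2 <= t]. *)
by have := ler_norm s; nra.
Qed.

End SignedPower.

Theorem lemma2p2 (R : realType) (alpha : R)
    (alpha_gt0 : 0 < alpha) (alpha_lt2 : alpha < 2)
    (n : R) (n_ge2 : 2 <= n) (s t : R) :
  `| (phi_trunc alpha n t - phi_trunc alpha n s)
       * (phi_trunc (2 - alpha) n t - phi_trunc (2 - alpha) n s)
     - (phi alpha t - phi alpha s) * (phi (2 - alpha) t - phi (2 - alpha) s) |
  <= 8 * n `^ (- Num.min alpha (2 - alpha)) * (t - s) ^+ 2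
     + 180 * (psi n t - psi n s) ^+ 2.
Proof.
rewrite -/(trunc_incr alpha (2 - alpha) n s t).
rewrite -/(phi_incr alpha (2 - alpha) s t).
have : alpha + (2 - alpha) = 2 by lra.
have : 0 < 2 - alpha by lra.
(* Abstracting [2 - alpha] makes the two exponents interchangeable. *)
move: (2 - alpha) => beta beta_gt0 ab; clear alpha_lt2.
wlog le_ab : alpha beta alpha_gt0 beta_gt0 ab / alpha <= beta.
  move=> H; have [|le_ba] := orP (le_total alpha beta); first exact: H.
  have := H _ _ beta_gt0 alpha_gt0 (ltac:(lra)) le_ba.
  rewrite minC /trunc_incr /phi_incr.
  by rewrite (mulrC (phi_trunc _ _ _ - _)) (mulrC (phi _ _ - _)).
rewrite min_l//.
wlog le_st : s t / `|s| <= `|t|.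
  move=> H; have [|le_ts] := orP (le_total `|s| `|t|); first exact: H.
  have := H _ _ le_ts; rewrite /trunc_incr /phi_incr.
  rewrite -(opprB t s) -(opprB (psi n t)) !sqrrN.
  rewrite -(opprB (phi_trunc alpha n t)) -(opprB (phi_trunc beta n t)).
  by rewrite -(opprB (phi alpha t)) -(opprB (phi beta t)) !mulrNN.
wlog t_ge0 : s t le_st / 0 <= t.
  move=> H; have [|t_le0] := orP (le_total 0 t); first exact: H.
  have := H (- s) (- t); rewrite !normrN oppr_ge0 => /(_ le_st t_le0).
  rewrite /trunc_incr /phi_incr /phi !psiN !phi_truncN !spowN -!opprD.
  by rewrite !mulrNN !sqrrN.
have ge1 : 1 <= n by lra.
have bound := @incr_diff_bound _ alpha beta n s t alpha_gt0 beta_gt0 ab ge1.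
have e0 : 0 <= n `^ (- alpha) * (t - s) ^+ 2.
  by rewrite mulr_ge0 ?powR_ge0 ?sqr_ge0.
have p0 := sqr_ge0 (psi n t - psi n s).
rewrite -[8 * _ * _]mulrA.
rewrite (ger0_norm t_ge0) in le_st.
have [tN|tN] := leP (n ^+ 4) t.
  by have := @psi_far _ n s t n_ge2 le_st tN; lra.
have sN := le_lt_trans le_st tN.
have [s1|s1] := leP 1 `|s|.
  have t1 := le_trans s1 le_st.
  rewrite /trunc_incr /phi_trunc (ger0_norm t_ge0) sN tN !ltNge s1 t1 /=.
  by rewrite /phi_incr /phi subrr normr0; lra.
have [tn|tn] := leP n t.
  by have := @incr_diff_mid _ _ _ n s t alpha_gt0 le_ab ab n_ge2 s1 tn tN; lra.
have sn := le_lt_trans le_st tn.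
(* Both arguments lie where [psi n] is the identity, so the [psi] term alone absorbs
   [2 * (t - s) ^+ 2]. *)
by move: p0; rewrite /psi (ger0_norm t_ge0) tn sn; lra.
Qed.
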